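(* Let $m$ be a positive integer. Then, for any integers $k$ and $n\ge 2\lfloor (m-1)/2\rfloor$, we have $$\sum_{i=0}^{\lfloor (m-1)/2\rfloor}(-1)^i\binom{m-1-i}{i}\genfrac{[}{]}{0pt}{}{n-2i}{k-i}_m=2^{n-m+1}+\delta_{m-2,\,n}\frac{(-1)^k}{2}.$$
   Context: For a positive integer $m$, a nonnegative integer $n$ and an integer $r$, define $$\genfrac{[}{]}{0pt}{}{n}{r}_m=\sum_{\substack{0\le k\le n\\ k\equiv r\ (\mathrm{mod}\ m)}}\binom nk .$$ The Kronecker symbol $\delta_{l,n}$ is $1$ if $l=n$ and $0$ otherwise. $\lfloor\alpha\rfloor$ is the integral part (floor) of the real number $\alpha$. The identity is between rational numbers (the exponent $n-m+1$ may be negative). *)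

(* Defs.v *)
From mathcomp Require Import all_boot all_order all_algebra.

Set Implicit Arguments.
Unset Strict Implicit.
Unset Printing Implicit Defensive.

Import GRing.Theory.
Local Open Scope ring_scope.

(* [n over r]_m; the congruence is taken in int because r may be negative. *)
Definition binmod (m n : nat) (r : int) : nat :=
  (\sum_(0 <= k < n.+1 | (k%:Z == r %[mod m%:Z])%Z) 'C(n, k))%N.

Definition kronecker (l n : int) : rat := if l == n then 1 else 0.

(* Main.v *)
Require Import Defs.
From mathcomp Require Import all_boot all_order all_algebra.
From mathcomp Require Import zify ring.

(** In terms of generating functions, [n over r]_m is the coefficient of x^r in
    (1 + x)^n modulo x^m - 1, so with a = m - 1 the left-hand side is the
    coefficient of x^k in
      sum_i (-1)^i C(a - i, i) x^i (1 + x)^(n - 2 i)   modulo x^m - 1.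
    For n = a this polynomial is 1 + x + ... + x^a: it expresses
    (x^m - y^m) / (x - y) through x + y and x y, at y = 1.  Hence for n >= a it
    is (1 + x + ... + x^a) (1 + x)^(n - a), and since x fixes 1 + x + ... + x^a
    modulo x^m - 1, all the coefficients are 2^(n - a).  The hypothesis on n
    leaves only one other case, m even and n = m - 2, where the polynomial is
    (1 + x + ... + x^a) / (1 + x) = 1 + x^2 + ... + x^(m - 2), whose coefficient
    at x^k is 1 or 0 according to the parity of k; this is 1/2 + (-1)^k / 2.

    The polynomials are avoided by working with any array F n k obeying Pascal's
    rule F (n + 1) k = F n k + F n (k - 1), where F n k plays the role of
    the coefficient of x^k in (1 + x)^n.  The sums [altsum F a n k] satisfy a
    two-step recurrence in a ([altsumSS]), from which the two closed forms
    [altsum_addn] and [altsum_double] follow by induction; [binmod_pascal]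
    makes them applicable, and [sum_binmod_period] and
    [sum_dvdz_even_period] evaluate the resulting sums over a period. *)

Set Implicit Arguments.
Unset Strict Implicit.
Unset Printing Implicit Defensive.

Import GRing.Theory.
Local Open Scope ring_scope.

(** * Alternating sums over an array obeying Pascal's rule *)

Section PascalArray.

Variables (R : comNzRingType) (F : nat -> int -> R).
Hypothesis F_pascal : forall n k, F n.+1 k = F n k + F n (k - 1).

(** The range stops at a rather than at a / 2, so that it grows by one with a
    and the recurrence in a needs no parity distinction; the additional binomial
    coefficients vanish. *)
Definition altsum (a n : nat) (k : int) : R :=
  \sum_(0 <= i < a.+1) (-1) ^+ i * 'C(a - i, i)%:R * F (n - 2 * i) (k - i%:Z).

Lemma altsum_half a n k :
  altsum a n k = \sum_(0 <= i < (a %/ 2).+1)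
                   (-1) ^+ i * 'C(a - i, i)%:R * F (n - 2 * i) (k - i%:Z).
Proof.
rewrite /altsum (big_cat_nat (n := (a %/ 2).+1)) //=; last by lia.
rewrite [X in _ + X]big_nat_cond [X in _ + X]big1 ?addr0 // => i /andP[/andP[lo hi] _].
by rewrite bin_small ?mulr0 ?mul0r //; lia.
Qed.

(** Pascal's rule for C(a + 2 - i, i); it mirrors the recurrence
    h_(a+2) = (x + y) h_(a+1) - x y h_a for h_a = (x^(a+1) - y^(a+1)) / (x - y). *)
Lemma altsumSS a n k :
  altsum a.+2 n.+2 k = altsum a.+1 n.+2 k - altsum a n (k - 1).
Proof.
rewrite /altsum big_nat_recr //= subnn bin0n mulr0 mul0r addr0.
rewrite big_nat_recl // [X in _ = X - _]big_nat_recl //.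
rewrite !bin0 -addrA; congr (_ + _).
rewrite -sumrB; apply: eq_big_nat => i /andP[_ hi].
have -> : (a.+2 - i.+1 = (a - i).+1)%N by lia.
have -> : (a.+1 - i.+1 = a - i)%N by lia.
have -> : (n.+2 - 2 * i.+1 = n - 2 * i)%N by lia.
have -> : k - i.+1%:Z = k - 1 - i%:Z by lia.
by rewrite binS natrD exprS; ring.
Qed.

(** In generating functions: the case p = 0 is the formula for
    (x^(a+1) - 1) / (x - 1), and both sides are then multiplied by (1 + x)^p. *)
Lemma altsum_addn a p k :
  altsum a (a + p) k = \sum_(0 <= j < a.+1) F p (k - j%:Z).
Proof.
elim/ltn_ind: a p k => -[|[|a]] IH p k.
- by rewrite /altsum !big_nat1 /= bin0 subn0 expr0 !mul1r.
- rewrite /altsum !big_nat_recr //= !big_geq // !add0r bin0 subn0 add1n.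
  by rewrite /= mulr0 mul0r addr0 expr0 !mul1r subr0 F_pascal.
rewrite !addSn altsumSS IH //.
have -> : ((a + p).+2 = a.+1 + p.+1)%N by lia.
rewrite IH // (eq_bigr _ (fun j _ => F_pascal p (k - j%:Z))) big_split /=.
(* F p (k - 1 - j) = F p (k - j.+1): all but the last of the shifted terms
   cancel. *)
rewrite [X in _ + X - _]big_nat_recr //= -addrA.
rewrite [RHS]big_nat_recr //=; congr (_ + _).
under eq_bigr do rewrite addrAC.
by rewrite addrC addKr; congr F; lia.
Qed.

(** In generating functions: (1 + x + ... + x^(2h+1)) / (1 + x)
    = 1 + x^2 + ... + x^(2h). *)
Lemma altsum_double h k :
  altsum (2 * h).+1 (2 * h) k = \sum_(0 <= j < h.+1) F 0 (k - (2 * j)%:Z).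
Proof.
elim: h k => [|h IH] k.
  rewrite /altsum !big_nat_recr //= !big_geq // !add0r.
  by rewrite mulr0 mul0r addr0 bin0 expr0 !mul1r.
have -> : (2 * h.+1 = (2 * h).+2)%N by lia.
rewrite altsumSS IH -[X in altsum _ X _]addn0 altsum_addn.
have split_parity N : \sum_(0 <= j < (2 * N).+1) F 0 (k - j%:Z)
    = \sum_(0 <= j < N.+1) F 0 (k - (2 * j)%:Z)
      + \sum_(0 <= j < N) F 0 (k - 1 - (2 * j)%:Z).
  elim: N => [|N IHN]; first by rewrite muln0 !big_nat1 muln0 big_geq // [RHS]addr0.
  have -> : (2 * N.+1 = (2 * N).+2)%N by lia.
  rewrite big_nat_recr //= big_nat_recr //= IHN [X in _ = X + _]big_nat_recr //=.
  rewrite [X in _ = _ + X]big_nat_recr //=.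
  have -> : k - (2 * N).+1%:Z = k - 1 - (2 * N)%:Z by lia.
  have -> : (2 * N.+1 = (2 * N).+2)%N by lia.
  ring.
have -> : (2 * h).+3 = (2 * h.+1).+1 by lia.
by rewrite split_parity addrK.
Qed.

End PascalArray.

(** * Binomial sums over a residue class *)

Lemma binmod_pascal m n r :
  binmod m n.+1 r = (binmod m n r + binmod m n (r - 1))%N.
Proof.
(* The term C(n, n + 1) = 0 is added to give both sides the same range. *)
have -> : binmod m n r
    = (\sum_(0 <= k < n.+2 | (k%:Z == r %[mod m%:Z])%Z) 'C(n, k))%N.
  by rewrite big_mkcond big_nat_recr //= -big_mkcond bin_small // if_same addn0.
rewrite /binmod !(big_mkcond (fun k : nat => _ == _)) /=.
rewrite big_nat_recl // [X in _ = (X + _)%N]big_nat_recl // !bin0 -addnA.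
congr addn; rewrite -big_split /=; apply: eq_big_nat => i _.
rewrite !eqz_mod_dvd.
have -> : i.+1%:Z - r = i%:Z - (r - 1) by lia.
by case: ifP => // _; rewrite binS.
Qed.

Lemma binmod0 m r : binmod m 0 r = (m%:Z %| r)%Z :> nat.
Proof.
by rewrite /binmod big_mkcond big_nat1 bin0 eqz_mod_dvd sub0r rpredN; case: ifP.
Qed.

(** The only nonzero term is the one where j is the residue of k. *)
Lemma sum_dvdz_period m (k : int) : (0 < m)%N ->
  (\sum_(0 <= j < m) (m%:Z %| (k - j%:Z)%R)%Z = 1)%N.
Proof.
move=> m_gt0; rewrite big_mkord.
have m_neq0 : m%:Z != 0 by lia.
have k_ge0 := modz_ge0 k m_neq0.
have k_ltm : (k %% m%:Z)%Z < m%:Z by apply: ltz_pmod; lia.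
have j0P : (`|(k %% m%:Z)%Z| < m)%N by lia.
have dvdE (j : 'I_m) : (m%:Z %| k - j%:Z)%Z = (j == Ordinal j0P).
  rewrite -eqz_mod_dvd -val_eqE /= modz_nat modn_small //.
  by apply/eqP/eqP; lia.
rewrite (bigD1 (Ordinal j0P)) // dvdE eqxx big1 // => j.
by rewrite dvdE => /negbTE ->.
Qed.

(** In generating functions: (1 + x)^n multiplies the fixed vector
    1 + x + ... + x^(m-1) of x modulo x^m - 1 by 2^n. *)
Lemma sum_binmod_period m n (k : int) : (0 < m)%N ->
  (\sum_(0 <= j < m) binmod m n (k - j%:Z)%R = 2 ^ n)%N.
Proof.
move=> m_gt0; elim: n k => [|n IH] k.
  by under eq_bigr do rewrite binmod0; rewrite sum_dvdz_period.
under eq_bigr do rewrite binmod_pascal.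
rewrite big_split /= IH.
under eq_bigr do rewrite addrAC.
by rewrite IH addnn expnS mul2n.
Qed.

(** The period 2 * d is traversed in steps of 2, which only meets the multiples
    of 2 * d when k is even. *)
Lemma sum_dvdz_even_period d (k : int) : (0 < d)%N ->
  (\sum_(0 <= j < d) ((2 * d)%N%:Z %| (k - (2 * j)%N%:Z)%R)%Z)%N%:R
    = (1 + (-1) ^ k) / 2 :> rat.
Proof.
move=> d_gt0; have sqrN1 : (-1 : rat) ^ (2 : int) = 1 by [].
have [l [->|->]] : exists l : int, k = 2 * l \/ k = 2 * l + 1.
  by exists (k %/ 2)%Z; lia.
- under eq_bigr => j _.
    have -> : 2 * l - (2 * j)%N%:Z = 2 * (l - j%:Z) by lia.
    rewrite PoszM dvdz_mul2l //=.
  over.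
  by rewrite sum_dvdz_period // -exprz_exp sqrN1 exp1rz.
rewrite big1 => [|j _].
  by rewrite expfzDr // -exprz_exp sqrN1 exp1rz mul1r expr1z subrr mul0r.
apply/eqP; rewrite eqb0; apply/negP => /(dvdz_trans _) -/(_ 2%:Z).
by rewrite PoszM dvdz_mulr // => /(_ isT); lia.
Qed.

Theorem theorem1p1 (m : nat) (hm : (0 < m)%N) (k : int) (n : nat)
  (hn : (2 * ((m - 1) %/ 2) <= n)%N) :
  \sum_(0 <= i < ((m - 1) %/ 2).+1)
      (-1 : rat) ^+ i * ('C(m - 1 - i, i))%:R * (binmod m (n - 2 * i) (k - i%:Z))%:R
  = (2 : rat) ^ (n%:Z - m%:Z + 1)
    + kronecker (m%:Z - 2) n%:Z * ((-1 : rat) ^ k / 2).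
Proof.
pose F n k : rat := (binmod m n k)%:R.
have F_pascal n' k' : F n'.+1 k' = F n' k' + F n' (k' - 1).
  by rewrite /F binmod_pascal natrD.
rewrite -(altsum_half F); have [le_mn | lt_nm] := leqP (m - 1) n.
- rewrite -(subnKC le_mn) altsum_addn // subnKC //.
  have -> : (m - 1).+1 = m by lia.
  rewrite -natr_sum sum_binmod_period // natrX exprnP.
  rewrite /kronecker ifF ?mul0r ?addr0; last by lia.
  by congr (_ ^ _); lia.
have [h [nE mE]] : exists h, n = (2 * h)%N /\ m = (2 * h.+1)%N.
  by exists (n %/ 2)%N; lia.
subst n m; have -> : (2 * h.+1 - 1 = (2 * h).+1)%N by lia.
rewrite altsum_double // -natr_sum.
under eq_bigr do rewrite binmod0.
rewrite sum_dvdz_even_period // /kronecker ifT; last by lia.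
have -> : (2 * h)%N%:Z - (2 * h.+1)%N%:Z + 1 = -1 by lia.
by rewrite mul1r mulrDl mul1r exprN1.
Qed.
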